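(* Let $G=(V,E)$ be a connected simple pfaffian graph which has no $4$-cycles. Let $G'=(V,E')$ be the graph on the same vertex set in which two distinct vertices $u,v$ are adjacent if and only if there is a path of length $2$ between $u$ and $v$ in $G$. Let $M'$ be a matching in $G'$, and let $V(M')$ be the set of vertices covered by $M'$. Then the number $\operatorname{perfmat} G$ of perfect matchings of $G$ satisfies $$\operatorname{perfmat} G\le\Bigl(\prod_{(u,v)\in M'}\bigl(d(u)d(v)-1\bigr)\Bigr)^{\frac14}\Bigl(\prod_{v\in V\setminus V(M')}d(v)\Bigr)^{\frac14},$$ where $d(v)$ denotes the degree of $v$ in $G$.
   Context: Graphs are finite. For an orientation of the edges of $G$, the skew symmetric adjacency matrix is $S(G)=[s_{uv}]_{u,v\in V}$ with $s_{uv}=1$ if the edge $(u,v)\in E$ is oriented from $u$ to $v$, $s_{uv}=-1$ if it is oriented from $v$ to $u$, and $s_{uv}=0$ if $(u,v)\notin E$. $G$ is pfaffian if it has an orientation with $\det S(G)=(\operatorname{perfmat} G)^2$. A matching is a (not necessarily perfect) set of pairwise disjoint edges. The length of a path is its number of edges; ''no $4$-cycles'' means that $G$ contains no cycle of length $4$ as a subgraph. *)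

(* Defs.v *)
From HB Require Import structures.
From mathcomp Require Import all_boot all_order all_algebra.

Set Implicit Arguments.
Unset Strict Implicit.
Unset Printing Implicit Defensive.

Import GRing.Theory.
Local Open Scope ring_scope.

(* A finite simple graph is given by a symmetric irreflexive adjacency
   relation e on a finite type T of vertices. *)

Definition is_connected (T : finType) (e : rel T) : Prop :=
  forall u v : T, connect e u v.

Definition degree (T : finType) (e : rel T) (v : T) : nat :=
  #|[set w | e v w]|.

Definition edges (T : finType) (e : rel T) : {set {set T}} :=
  [set [set p.1; p.2] | p : T * T & e p.1 p.2].

Definition matching (T : finType) (e : rel T) (M : {set {set T}}) : bool :=
  (M \subset edges e) && trivIset M.

Definition covered (T : finType) (M : {set {set T}}) : {set T} := cover M.

Definition perfect_matching (T : finType) (e : rel T) (M : {set {set T}}) :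
  bool := matching e M && (covered M == [set: T]).

Definition perfmat (T : finType) (e : rel T) : nat :=
  #|[set M | perfect_matching e M]|.

(* o u v means that the edge uv is oriented from u to v. *)
Definition orientation (T : finType) (e o : rel T) : Prop :=
  (forall u v : T, o u v -> e u v) /\
  (forall u v : T, e u v -> o u v (+) o v u).

Definition skew_adjacency (T : finType) (o : rel T) : 'M[int]_#|T| :=
  \matrix_(i, j)
    (if o (enum_val i) (enum_val j) then 1
     else if o (enum_val j) (enum_val i) then -1 else 0).

Definition pfaffian (T : finType) (e : rel T) : Prop :=
  exists2 o : rel T, orientation e o &
    \det (skew_adjacency o) = (perfmat e)%:R ^+ 2.

(* A list c of length 4 with ucycle e c is a cycle through four distinct
   vertices. *)
Definition no_4cycle (T : finType) (e : rel T) : Prop :=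
  forall c : seq T, ucycle e c -> size c <> 4%N.

Definition path_of_length (T : finType) (e : rel T) (n : nat) (u v : T) :
  bool :=
  [exists p : n.-tuple T, [&& path e u p, last u p == v & uniq (u :: p)]].

Definition two_path_graph (T : finType) (e : rel T) : rel T :=
  [rel u v | (u != v) && path_of_length e 2 u v].

(* Main.v *)
Require Import Defs.
From HB Require Import structures.
From mathcomp Require Import all_boot all_order all_algebra.
From mathcomp Require Import perm reals exp.

Set Implicit Arguments.
Unset Strict Implicit.
Unset Printing Implicit Defensive.

(* For a pfaffian orientation with skew adjacency matrix S, (perfmat G)^4 is
   det(S S^T), the Gram determinant of the rows of S. Fischer's inequality
   bounds it by the product of the Gram determinants of the blocks of any
   partition of the rows; take the edges of M' and the uncovered vertices as
   blocks. The row of v has squared norm d(v), and if u and v are joined by a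
   path of length 2 then, as there are no 4-cycles, they have exactly one common
   neighbour, so their rows have inner product 1 or -1 and the block {u, v}
   contributes d(u) d(v) - 1. *)

Import Order.TTheory GRing.Theory Num.Theory.
Local Open Scope ring_scope.

Lemma det_mx2 (R : comNzRingType) (A : 'M[R]_2) :
  \det A = A 0 0 * A 1 1 - A 0 1 * A 1 0.
Proof.
rewrite (expand_det_row _ 0) 2!big_ord_recl big_ord0 addr0 /cofactor.
rewrite !det_mx11 !mxE expr0 expr1 mul1r mulN1r mulrN.
by congr (_ * A _ _ - A _ _ * A _ _); apply: val_inj.
Qed.

(** * Gram determinants and Fischer's inequality *)

Section Gram.

Variables (F : realFieldType) (m : nat).
Implicit Types (x y : 'rV[F]_m) (s t : seq 'rV[F]_m).

Definition dotr x y : F := (x *m y^T) 0 0.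

(** With lists, a partition into blocks is a concatenation and Fischer's inequality is an
    induction. *)
Definition rows s : 'M[F]_(size s, m) := \matrix_(i < size s) nth 0 s i.

Definition gram s : F := \det (rows s *m (rows s)^T).

Lemma dotrE x y : dotr x y = \sum_j x 0 j * y 0 j.
Proof. by rewrite /dotr mxE; apply: eq_bigr => j _; rewrite !mxE. Qed.

Lemma dotr_ge0 x : 0 <= dotr x x.
Proof. by rewrite dotrE sumr_ge0 // => j _; rewrite -expr2 sqr_ge0. Qed.

Lemma dotr_eq0 x : dotr x x = 0 -> x = 0.
Proof.
rewrite dotrE => /eqP; rewrite psumr_eq0; last first.
  by move=> j _; rewrite -expr2 sqr_ge0.
move/allP=> x0; apply/rowP => j; rewrite mxE.
have := x0 j; rewrite mem_index_enum -expr2 sqrf_eq0 /=.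
by move=> /(_ isT)/eqP.
Qed.

Lemma rows_cons x s : rows (x :: s) = col_mx x (rows s) :> 'M_(1 + size s, m).
Proof.
apply/matrixP=> i j; rewrite !mxE; case: splitP => k ik.
  by rewrite ord1 in ik *; rewrite ik.
by rewrite ik !mxE.
Qed.

Lemma gram_nil : gram [::] = 1.
Proof. exact: det_mx00. Qed.

(** A row operation of determinant 1 turns [x] into [x']; orthogonality then makes the Gram matrix
    block triangular. *)
Lemma gram_cons x s (a : 'rV_(size s)) (x' := x - a *m rows s) :
  x' *m (rows s)^T = 0 -> gram (x :: s) = dotr x' x' * gram s.
Proof.
move=> orth; set Y := rows s in x' orth *.
pose U : 'M[F]_(1 + size s) := block_mx 1 (- a) 0 1%:M.
have UE : U *m col_mx x Y = col_mx x' Y.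
  by rewrite mul_block_col mul1mx mulNmx mul0mx mul1mx add0r.
have detU : \det U = 1 by rewrite det_ublock !det1 mulr1.
have -> : gram (x :: s) = \det (col_mx x Y *m (col_mx x Y)^T).
  by rewrite /gram rows_cons.
transitivity (\det (U *m col_mx x Y *m (U *m col_mx x Y)^T)).
  by rewrite trmx_mul mulmxA -(mulmxA U) !det_mulmx det_tr detU mulr1 mul1r.
rewrite UE tr_col_mx mul_col_row orth det_lblock; congr (_ * _).
by rewrite det_mx11.
Qed.

(** A vector [a] killing the Gram matrix makes [a *m rows s] have norm zero, so it is a linear
    relation among the rows; padded with a zero it remains one for the longer list. *)
Lemma gram_cons_eq0 x s : gram s = 0 -> gram (x :: s) = 0.
Proof.
move=> /eqP/det0P[a a0 aYY].
have aY : a *m rows s = 0.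
  by apply: dotr_eq0; rewrite /dotr trmx_mul mulmxA -(mulmxA a) aYY mul0mx mxE.
apply/eqP/(@det0P _ (1 + size s)); exists (row_mx 0 a).
  apply: contra a0 => /eqP/(congr1 rsubmx).
  by rewrite row_mxKr => ->; apply/eqP/rowP => j; rewrite !mxE.
by rewrite rows_cons mulmxA mul_row_col aY mul0mx addr0 mul0mx.
Qed.

(** An invertible Gram matrix lets the normal equations for projecting [x] onto the span of [s] be
    solved. *)
Lemma orthogonal_residual x s : gram s != 0 ->
  exists a : 'rV_(size s), (x - a *m rows s) *m (rows s)^T = 0.
Proof.
rewrite -unitfE => uG.
exists (x *m (rows s)^T *m invmx (rows s *m (rows s)^T)).
by rewrite mulmxBl -!mulmxA mulVmx ?mulmx1 ?subrr.
Qed.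

Lemma gram_ge0 s : 0 <= gram s.
Proof.
elim: s => [|x s IHs]; first by rewrite gram_nil.
have [/(gram_cons_eq0 x)->//|/(orthogonal_residual x)[a /gram_cons->]] :=
  eqVneq (gram s) 0.
by rewrite mulr_ge0 ?dotr_ge0.
Qed.

(* Pythagoras: the squared distance from [x] to the row space of [Z] is at most
   the squared distance from [x] to any point of it. *)
Lemma orthogonal_residual_le k (Z : 'M[F]_(k, m)) x (b c : 'rV_k)
    (x1 := x - b *m Z) (x2 := x - c *m Z) :
  x1 *m Z^T = 0 -> dotr x1 x1 <= dotr x2 x2.
Proof.
move=> orth; pose d := (b - c) *m Z.
have -> : x2 = x1 + d by rewrite /x1 /x2 /d mulmxBl addrA subrK.
have x1d : x1 *m d^T = 0 by rewrite trmx_mul mulmxA orth mul0mx.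
have dx1 : d *m x1^T = 0 by rewrite -[RHS]trmx0 -x1d trmx_mul trmxK.
rewrite {2}/dotr linearD /= mulmxDl !mulmxDr x1d dx1 addr0 add0r mxE.
by rewrite lerDl dotr_ge0.
Qed.

Lemma rows_catl_sub s t : (rows s <= rows (s ++ t))%MS.
Proof.
apply/row_subP => i; have lt_i : (i < size (s ++ t))%N.
  by rewrite size_cat ltn_addr.
rewrite (_ : row i _ = row (Ordinal lt_i) (rows (s ++ t))) ?row_sub //.
by rewrite !rowK nth_cat /= ltn_ord.
Qed.

(* Adding a row to [s] multiplies its Gram determinant by the squared distance
   from that row to the span of [s], which can only drop for the span of
   [s ++ t]. *)
Lemma fischer s t : gram (s ++ t) <= gram s * gram t.
Proof.
elim: s => [|x s IHs]; first by rewrite gram_nil mul1r.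
have [st0|st0] := eqVneq (gram (s ++ t)) 0.
  by rewrite /= gram_cons_eq0 // mulr_ge0 ?gram_ge0.
(* Were [gram s] zero, the induction hypothesis and nonnegativity would force [gram (s ++ t)] to
   vanish. So [x] can be projected onto both spans. *)
have s0 : gram s != 0.
  apply: contraNneq st0 => s0; rewrite s0 mul0r in IHs.
  by rewrite eq_le IHs gram_ge0.
have [a aP] := orthogonal_residual x s0.
have [b bP] := orthogonal_residual x st0.
rewrite /= (gram_cons aP) (gram_cons bP) -mulrA.
apply: ler_pM => //; rewrite ?dotr_ge0 ?gram_ge0 //.
(* The projection onto the span of [s] is a competing point in the span of [s ++ t]. *)
have /submxP[D ->] := rows_catl_sub s t.
by rewrite mulmxA; exact: orthogonal_residual_le.
Qed.

Lemma fischer_flatten (ss : seq (seq 'rV[F]_m)) :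
  gram (flatten ss) <= \prod_(s <- ss) gram s.
Proof.
elim: ss => [|s ss IHss] /=; first by rewrite big_nil gram_nil.
by rewrite big_cons (le_trans (fischer _ _)) // ler_wpM2l // gram_ge0.
Qed.

Lemma gram1 x : gram [:: x] = dotr x x.
Proof.
rewrite /gram (det_mx11 (_ : 'M_1)) /dotr !mxE.
by apply: eq_bigr => k _; rewrite !mxE.
Qed.

Lemma gram2 x y :
  gram [:: x; y] = dotr x x * dotr y y - dotr x y ^+ 2.
Proof.
rewrite /gram (det_mx2 (_ : 'M_2)) /dotr.
have E i j : (rows [:: x; y] *m (rows [:: x; y])^T) i j =
    (nth 0 [:: x; y] i *m (nth 0 [:: x; y] j)^T) 0 0.
  by rewrite !mxE; apply: eq_bigr => k _; rewrite !mxE.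
rewrite !E /= expr2; congr (_ - _ * _).
by rewrite !mxE; apply: eq_bigr => k _; rewrite !mxE mulrC.
Qed.

(** The dimension [size s] is built into the type; this trades it for any provably equal [n]. *)
Lemma gramE n s : size s = n -> gram s =
  \det (\matrix_(i < n) nth 0 s i *m (\matrix_(i < n) nth 0 s i)^T).
Proof. by move <-. Qed.

(** The sign of the permutation matrix enters twice and cancels. *)
Lemma perm_gram s t : perm_eq s t -> gram s = gram t.
Proof.
move=> st; rewrite (gramE (perm_size st)).
have /tuple_permP[p sE] : perm_eq s (in_tuple t) by [].
have -> : \matrix_(i < size t) nth 0 s i = perm_mx p *m rows t.
  rewrite -row_permE; apply/matrixP => i j; rewrite !mxE sE.
  by rewrite -tnth_nth tnth_mktuple (tnth_nth 0).
rewrite trmx_mul mulmxA -(mulmxA (perm_mx p)) !(det_mulmx, det_tr).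
by rewrite mulrC mulrA det_perm -signr_addb addbb mul1r.
Qed.

End Gram.

Lemma gram_square (F : realFieldType) n (A : 'M[F]_n) (s : seq 'I_n) :
  perm_eq s (enum 'I_n) -> gram [seq row i A | i <- s] = \det A ^+ 2.
Proof.
move=> /(perm_map (fun i => row i A))/perm_gram->.
rewrite (@gramE _ _ n); last by rewrite size_map size_enum_ord.
rewrite (_ : \matrix_(i < n) _ = A) ?det_mulmx ?det_tr ?expr2 //.
apply/row_matrixP => i; rewrite rowK (nth_map i) ?size_enum_ord //.
by rewrite nth_ord_enum.
Qed.

(** Multiplicities agree: by disjointness, the counts over the members of [P] add up to the count
    over [cover P]. *)
Lemma perm_enum_trivIset (T : finType) (P : {set {set T}}) :
  trivIset P ->
  perm_eq (flatten [seq enum f | f : {set T} <- enum P] ++ enum (~: cover P))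
          (enum T).
Proof.
move=> trivP; apply/allP => x _ /=; apply/eqP.
rewrite count_cat count_flatten sumnE !big_map big_enum /=.
have countE (A : {set T}) : count_mem x (enum A) = (\sum_(y in A) (y == x))%N.
  by rewrite -sumn_count sumnE big_map big_enum.
rewrite (eq_bigr _ (fun f _ => countE f)) -big_trivIset // -countE.
rewrite !count_uniq_mem ?enum_uniq // !mem_enum !inE.
by case: (x \in cover P).
Qed.

(** * Inner products of rows of the skew adjacency matrix *)

Section SkewAdjacency.

Variables (R : realFieldType) (T : finType) (e o : rel T).
Hypotheses (e_sym : symmetric e) (e_irr : irreflexive e).
Hypothesis o_orient : orientation e o.

Definition sgnb u v : int := if o u v then 1 else if o v u then -1 else 0.

Definition skew_row v : 'rV[R]_#|T| :=
  row (enum_rank v) (map_mx intr (skew_adjacency o)).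

Lemma dotr_skew_row u v :
  dotr (skew_row u) (skew_row v) = \sum_w (sgnb u w * sgnb v w)%:~R.
Proof.
rewrite dotrE (reindex (@enum_rank T)) /=; last exact/onW_bij/enum_rank_bij.
by apply: eq_bigr => w _; rewrite !mxE !enum_rankK intrM.
Qed.

Lemma sqr_sgnb u v : sgnb u v * sgnb u v = (e u v)%:R.
Proof.
have [oe eo] := o_orient; rewrite /sgnb.
have [/oe->|Nouv] := ifPn; first by [].
have [/oe|Novu] := ifPn; first by rewrite e_sym => ->.
have [/eo|] := boolP (e u v); last by [].
by rewrite (negPf Nouv) (negPf Novu).
Qed.

Lemma dotr_skew_row_diag v :
  dotr (skew_row v) (skew_row v) = (degree e v)%:R.
Proof.
rewrite dotr_skew_row /degree cardsE -sum1_card natr_sum [RHS]big_mkcond.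
by apply: eq_bigr => w _; rewrite sqr_sgnb -topredE /=; case: (e v w).
Qed.

Lemma sqr_dotr_skew_row u v : no_4cycle e -> two_path_graph e u v ->
  dotr (skew_row u) (skew_row v) ^+ 2 = 1.
Proof.
move=> noC4 /andP[neq_uv /existsP[[[|w [|z []]] //= _]]].
move=> /and3P[/and3P[euw ewz _] /eqP zv _]; subst z.
have sgnN0 x y : e x y -> sgnb x y ^+ 2 = 1 by rewrite expr2 sqr_sgnb => ->.
have sgn0 x y : ~~ e x y -> sgnb x y = 0.
  by move=> /negPf Nexy; apply/eqP; rewrite -sqrf_eq0 expr2 sqr_sgnb Nexy.
(* The midpoint [w] of the path contributes a product of two signs; every other term is shown to
   vanish. *)
rewrite dotr_skew_row (bigD1 w) //= big1 => [|z neq_zw].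
  by rewrite addr0 -rmorphXn /= exprMn !sgnN0 // e_sym.
have [euz|/sgn0->] := boolP (e u z); last by rewrite mul0r.
have [evz|/sgn0->] := boolP (e v z); last by rewrite mulr0.
have eN x y : e x y -> x != y by apply: contraTneq => ->; rewrite e_irr.
(* A second common neighbour [z] would close a 4-cycle. *)
case: (noC4 [:: u; w; v; z]) => //.
rewrite /ucycle /= euw ewz evz e_sym euz /= !inE !negb_or.
by rewrite neq_uv [w == z]eq_sym neq_zw !eN.
Qed.

End SkewAdjacency.

Lemma gram_skew_edge (R : realFieldType) (T : finType) (e o : rel T)
    (f : {set T}) :
  symmetric e -> irreflexive e -> orientation e o -> no_4cycle e ->
  f \in edges (two_path_graph e) ->
  gram [seq skew_row R o v | v <- enum f] =
  (\prod_(v in f) (degree e v)%:R) - 1.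
Proof.
move=> e_sym e_irr o_orient noC4 /imsetP[[u v] /= uv ->].
rewrite inE /= in uv; have /andP[neq_uv _] := uv.
have/perm_gram-> : perm_eq [seq skew_row R o v | v <- enum [set u; v]]
    [:: skew_row R o u; skew_row R o v].
  apply: (perm_map _ (t := [:: u; v])); apply: uniq_perm.
  - exact: enum_uniq.
  - by rewrite /= inE neq_uv.
  - by move=> x; rewrite mem_enum !inE.
rewrite gram2 !(dotr_skew_row_diag _ e_sym) // (sqr_dotr_skew_row _ e_sym) //.
by rewrite big_setU1 ?inE //= big_set1.
Qed.

(** * The bound on perfect matchings *)

Theorem theorem5p1 (R : realType) (T : finType) (e : rel T)
    (e_sym : symmetric e) (e_irr : irreflexive e)
    (e_conn : is_connected e) (e_pfaff : pfaffian e) (e_C4 : no_4cycle e)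
    (M' : {set {set T}}) (M'_matching : matching (two_path_graph e) M') :
  ((perfmat e)%:R : R) <=
    (\prod_(f in M') ((\prod_(v in f) (degree e v)%:R) - 1)) `^ (1 / 4)
    * (\prod_(v in ~: covered M') (degree e v)%:R) `^ (1 / 4).
Proof.
have [o o_orient det_o] := e_pfaff.
have /andP[/subsetP M'E trivM'] := M'_matching.
set P1 := \prod_(f in M') _; set P2 := \prod_(v in ~: _) _.
pose blocks := [seq enum f | f : {set T} <- enum M']
  ++ [seq [:: v] | v <- enum (~: cover M')].
have perm_blocks : perm_eq (flatten blocks) (enum T).
  by rewrite flatten_cat flatten_seq1 perm_enum_trivIset.
have perm_ranks :
    perm_eq [seq enum_rank v | v <- flatten blocks] (enum 'I_#|T|).
  apply: uniq_perm; rewrite ?enum_uniq //.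
    by rewrite (map_inj_uniq enum_rank_inj) (perm_uniq perm_blocks) enum_uniq.
  move=> i; rewrite mem_enum inE -[i]enum_valK map_f //.
  by rewrite (perm_mem perm_blocks) mem_enum.
(* Each factor is a Gram determinant. The sign is needed to distribute the real power over
   [P1 * P2]. *)
have P1_ge0 : 0 <= P1.
  rewrite prodr_ge0 // => f /M'E fE.
  by rewrite -(gram_skew_edge _ e_sym e_irr o_orient) ?gram_ge0.
have P2_ge0 : 0 <= P2 by rewrite prodr_ge0.
have le4 : (perfmat e)%:R ^+ 4 <= P1 * P2.
  have -> : (perfmat e)%:R ^+ 4
      = \det (map_mx intr (skew_adjacency o) : 'M[R]_#|T|) ^+ 2.
    by rewrite det_map_mx det_o rmorphXn /= -exprM mulrz_nat.
  rewrite -(gram_square _ perm_ranks).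
  rewrite -map_comp map_flatten.
  (* Only Fischer's inequality loses anything: the block determinants equal the factors of [P1] and
     [P2]. *)
  apply: le_trans (fischer_flatten _) _; rewrite !big_map big_cat !big_map /=.
  rewrite !big_enum /= le_eqVlt; apply/predU1l; congr (_ * _).
    by apply: eq_bigr => f /M'E; apply: gram_skew_edge.
  by apply: eq_bigr => v _; rewrite gram1 (dotr_skew_row_diag _ e_sym).
have -> : (perfmat e)%:R = ((perfmat e)%:R ^+ 4 : R) `^ (1 / 4).
  by rewrite -powR_mulrn // -powRrM div1r mulfV ?pnatr_eq0 ?powRr1.
rewrite -powRM //.
apply: ge0_ler_powR le4; first exact: divr_ge0.
- by rewrite nnegrE exprn_ge0.
- by rewrite nnegrE mulr_ge0.
Qed.
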